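(* Let $G$ be a finitely generated group with undecidable domino problem. Then all nontrivial dynamical properties of sofic $G$-subshifts are undecidable. That is, if $\mathscr{P}$ is a dynamical property of sofic $G$-subshifts such that some sofic $G$-subshift satisfies $\mathscr{P}$ and some sofic $G$-subshift does not, then the set of sofic $G$-subshift presentations $(A,\mathcal{F},\mu,B)$ such that $Y_{(A,\mathcal{F},\mu,B)}$ satisfies $\mathscr{P}$ is not decidable.
   Context: Let $G$ be a finitely generated group and fix a finite symmetric generating set $S$ of $G$. For a word $w\in S^{*}$, $\underline{w}\in G$ denotes the corresponding group element, and $\pi\colon S^{*}\to G$ is $\pi(w)=\underline{w}$. Subshifts. For a finite alphabet $A$, $A^G=\{x\colon G\to A\}$ carries the prodiscrete topology and the shift action $(gx)(h)=x(g^{-1}h)$. A subshift is a closed shift-invariant subset of $A^G$; the empty set is allowed. A morphism of subshifts is a continuous map commuting with the shift action; a conjugacy is a bijective morphism. SFT presentations. A pattern presentation is a function $p\colon W\to A$ with $W\subset S^{*}$ finite and $A\subset\mathbb{N}$ a finite alphabet. It appears in $x\in A^G$ at $g\in G$ when $x(g\underline{w})=p(w)$ for every $w\in W$. A $G$-SFT presentation is a pair $(A,\mathcal{F})$ with $A\subset\mathbb{N}$ a finite alphabet and $\mathcal{F}$ a finite set of pattern presentations $p\colon W\to A$. It determines the subshift $X_{(A,\mathcal{F})}\subset A^G$ of all configurations in which no element of $\mathcal{F}$ appears (at any $g\in G$); such subshifts are called $G$-SFTs. The domino problem of $G$ is the set $\operatorname{DP}(G)$ of all SFT presentations $(A,\mathcal{F})$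 such that $X_{(A,\mathcal{F})}=\emptyset$; $G$ has undecidable domino problem if this set is not decidable. Sofic presentations. A local function presentation is a function $\mu\colon A^{W}\to B$, where $W\subset S^{*}$ is finite and $A,B\subset\mathbb{N}$ are finite. It presents the local function $\mu_0\colon A^{D}\to B$, where $D=\pi(W)$ and $\mu_0(p)=\mu(p\circ\pi|_W)$. A sofic $G$-subshift presentation is a tuple $(A,\mathcal{F},\mu,B)$ where $A,B\subset\mathbb{N}$ are finite alphabets, $(A,\mathcal{F})$ is a $G$-SFT presentation, and $\mu\colon A^{W}\to B$ is a local function presentation. The associated sofic subshift $Y_{(A,\mathcal{F},\mu,B)}\subset B^G$ is the image of $X_{(A,\mathcal{F})}$ under the map $\phi$ given by $\phi(x)(g)=\mu_0((g^{-1}x)|_{D})$. Sofic $G$-subshifts are the subshifts of this form; the empty subshift is one of them. A dynamical property of sofic $G$-subshifts is a property (with a yes/no value also assigned to the empty subshift) that is invariant under conjugacy. *)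

(* Defs.v *)
From HB Require Import structures.
From mathcomp Require Import all_boot finmap.
From mathcomp Require Import boolp classical_sets functions.
From mathcomp Require Import topology.

Set Implicit Arguments.
Unset Strict Implicit.
Unset Printing Implicit Defensive.

Local Open Scope classical_set_scope.

(* The total recursive functions of any arity, in the classical formulation
   where minimization is only applied to regular functions.  The result [h] of
   each scheme is given by its pointwise values, so that [recursive] does not
   distinguish extensionally equal functions. *)
Inductive recursive : forall k : nat, (k.-tuple nat -> nat) -> Prop :=
| rec_zero (h : 0.-tuple nat -> nat) :
    (forall v, h v = 0) -> recursive h
| rec_succ (h : 1.-tuple nat -> nat) :
    (forall v, h v = (thead v).+1) -> recursive h
| rec_proj (k : nat) (i : 'I_k) (h : k.-tuple nat -> nat) :
    (forall v, h v = tnth v i) -> recursive h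
| rec_comp (m k : nat) (f : m.-tuple nat -> nat)
    (g : 'I_m -> k.-tuple nat -> nat) (h : k.-tuple nat -> nat) :
    recursive f -> (forall i, recursive (g i)) ->
    (forall v, h v = f [tuple g i v | i < m]) ->
    recursive h
| rec_prim (k : nat) (f : k.-tuple nat -> nat) (g : k.+2.-tuple nat -> nat)
    (h : k.+1.-tuple nat -> nat) :
    recursive f -> recursive g ->
    (forall v : k.-tuple nat, h [tuple of 0 :: v] = f v) ->
    (forall n (v : k.-tuple nat),
      h [tuple of n.+1 :: v] = g [tuple of n :: h [tuple of n :: v] :: v]) ->
    recursive h
| rec_mu (k : nat) (g : k.+1.-tuple nat -> nat) (h : k.-tuple nat -> nat) :
    recursive g ->
    (forall v : k.-tuple nat, g [tuple of h v :: v] = 0 /\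
      forall n, n < h v -> g [tuple of n :: v] <> 0) ->
    recursive h.

(* The Goedel number of [t : T] is [pickle t].  For the types below, built from
   finite types and [nat] by lists, pairs and boolean subtypes, this is the
   explicit coding obtained by iterating [CodeSeq.code : seq nat -> nat]. *)
Definition decidable_set (T : countType) (D : set T) : Prop :=
  exists f : 1.-tuple nat -> nat,
    recursive f /\ forall t : T, D t <-> f [tuple choice.pickle t] = 1.

Section Subshifts.
Variables (G : groupType) (S : {fset G}).

Definition symmetric_set : Prop := forall s, s \in S -> s^-1%g \in S.

(* [S] also denotes the finite type of its elements, so [word] is S^*. *)
Definition word : Type := seq S.

Definition word_eval (w : word) : G := (\prod_(s <- w) fsval s)%g.

Definition generating_set : Prop := forall g : G, exists w, word_eval w = g.

(* All alphabets are finite subsets A of [nat], and A^G is seen inside nat^G;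
   the prodiscrete topology of A^G is induced by that of nat^G. *)
Definition config : Type := {ptws G -> nat}.

Definition shift (g : G) (x : config) : config := fun h => x (g^-1 * h)%g.

Definition morphism (X Y : set config) (f : config -> config) : Prop :=
  [/\ set_fun X Y f, {within X, continuous f} &
      forall g x, X x -> f (shift g x) = shift g (f x)].

Definition conjugate (X Y : set config) : Prop :=
  exists f, morphism X Y f /\ set_bij X Y f.

(* A map p : W -> A is given by its graph, and a finite set by a list of its
   elements. *)
Definition pattern : Type := seq (word * nat).

Definition pattern_over (A : seq nat) (p : pattern) : bool :=
  uniq (unzip1 p) && all (mem A) (unzip2 p).

Definition appears (p : pattern) (x : config) (g : G) : Prop :=
  forall w a, (w, a) \in p -> x (g * word_eval w)%g = a.

Definition sft_presentation : Type :=
  {P : seq nat * seq pattern | all (pattern_over P.1) P.2}.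

HB.instance Definition _ := Countable.on sft_presentation.

Definition sft (P : sft_presentation) : set config :=
  [set x | (forall g, x g \in (val P).1) /\
    forall p, p \in (val P).2 -> forall g, ~ appears p x g].

Definition DP : set sft_presentation := [set P | sft P = set0].

(* A function mu : A^W -> B is given by the list W and by its graph, in which
   q : W -> A is replaced by the list of its values along W. *)
Definition local_function : Type := (seq word * seq (seq nat * nat))%type.

Definition local_function_over (A B : seq nat) (mu : local_function) : bool :=
  [&& uniq mu.1, uniq (unzip1 mu.2),
      all (fun q => (size q == size mu.1) && all (mem A) q) (unzip1 mu.2),
      [forall q : (size mu.1).-tuple (seq_sub A),
        [seq ssval a | a <- q] \in unzip1 mu.2] &
      all (mem B) (unzip2 mu.2)].

(* mu_0 applied to the restriction of [x] to the image of W in G. *)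
Definition local_value (mu : local_function) (x : config) : nat :=
  nth 0 (unzip2 mu.2)
    (index [seq x (word_eval w) | w <- mu.1] (unzip1 mu.2)).

Definition local_map (mu : local_function) (x : config) : config :=
  fun g => local_value mu (shift g^-1%g x).

(* The components are the SFT presentation (A, F), mu and B. *)
Definition sofic_presentation : Type :=
  {Q : sft_presentation * local_function * seq nat |
    local_function_over (val Q.1.1).1 Q.2 Q.1.2}.

HB.instance Definition _ := Countable.on sofic_presentation.

Definition sofic_subshift (Q : sofic_presentation) : set config :=
  local_map (val Q).1.2 @` sft (val Q).1.1.

Definition sofic (Y : set config) : Prop := exists Q, sofic_subshift Q = Y.

Definition dynamical_property (P : set config -> Prop) : Prop :=
  forall X Y, sofic X -> sofic Y -> conjugate X Y -> (P X <-> P Y).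

End Subshifts.

(* Main.v *)
Require Import Defs.
From mathcomp Require Import all_boot finmap.
From mathcomp Require Import boolp classical_sets functions.
From mathcomp Require Import topology.

Set Implicit Arguments.
Unset Strict Implicit.
Unset Printing Implicit Defensive.

Local Open Scope classical_set_scope.

(** The theorem holds because emptiness of an SFT can be converted, effectively,
    into membership in the property.  Fix a sofic subshift Y, the image of an
    SFT X0 under a local map.  For an SFT X, the product X * X0 is again an SFT,
    and applying the local map to its second factor gives Y when X is nonempty
    and the empty subshift when X is empty; the subshift obtained is literally
    Y or empty, not only up to conjugacy ([product_sofic_nonempty],
    [product_sofic_empty]).  Since the property is nontrivial, Y can be chosen
    on the side of the property opposite to that of the empty subshift, and
    then a decision procedure for the property solves the domino problem
    ([decidable_DP]).

    What remains is that a presentation of the product depends recursively on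
    the presentation of X ([computable_product_sofic]), for the class of
    recursive functions of tuples of numbers and the Goedel numbering given by
    [choice.pickle].  A pair is coded as a list of length two and a list
    a :: s as 2 ^ a * (2 * code s + 1), so that consing, head and tail are
    recursive.  On top of this, [computable] functions between countable types
    are closed under pairing, comparison and folding over lists, the latter by
    iterating a step function on a number bounding the length of the list.
    All the list functions used by the product construction are built from
    folds.

    In the product, the letter (a, b) is the number coding this pair.  Hence
    the projections of letters are the recursive functions used to
    decode pairs, for all alphabets alike.  A forbidden pattern of one factor
    becomes the finite set of its lifts, the patterns with the same support
    over the product alphabet which project to it. *)

(** * Recursive functions of few arguments *)

Definition recursive1 (f : nat -> nat) : Prop :=
  recursive (fun v : 1.-tuple nat => f (nth 0 v 0)).
Definition recursive2 (f : nat -> nat -> nat) : Prop :=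
  recursive (fun v : 2.-tuple nat => f (nth 0 v 0) (nth 0 v 1)).
Definition recursive3 (f : nat -> nat -> nat -> nat) : Prop :=
  recursive (fun v : 3.-tuple nat => f (nth 0 v 0) (nth 0 v 1) (nth 0 v 2)).

Lemma recursive_nth k i : i < k ->
  recursive (fun v : k.-tuple nat => nth 0 v i).
Proof.
by move=> ltik; apply: (@rec_proj k (Ordinal ltik)) => v; rewrite (tnth_nth 0).
Qed.

Lemma nth_mktuple_nat k (f : 'I_k -> nat) i (ltik : i < k) :
  nth 0 [tuple f j | j < k] i = f (Ordinal ltik).
Proof. by rewrite -(tnth_nth 0 _ (Ordinal ltik)) tnth_mktuple. Qed.

Lemma recursive1_comp k f (a : k.-tuple nat -> nat) :
  recursive1 f -> recursive a -> recursive (fun v => f (a v)).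
Proof.
move=> rf ra; apply: (rec_comp (g := fun _ => a) rf) => // v.
by rewrite nth_mktuple_nat.
Qed.

Lemma recursive2_comp k f (a b : k.-tuple nat -> nat) :
  recursive2 f -> recursive a -> recursive b ->
  recursive (fun v => f (a v) (b v)).
Proof.
move=> rf ra rb.
apply: (rec_comp (g := fun i : 'I_2 => nth a [:: a; b] i) rf) => [|v].
  by case=> [[|[|i]]].
by rewrite !nth_mktuple_nat.
Qed.

Lemma recursive3_comp k f (a b c : k.-tuple nat -> nat) :
  recursive3 f -> recursive a -> recursive b -> recursive c ->
  recursive (fun v => f (a v) (b v) (c v)).
Proof.
move=> rf ra rb rc.
apply: (rec_comp (g := fun i : 'I_3 => nth a [:: a; b; c] i) rf) => [|v].
  by case=> [[|[|[|i]]]].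
by rewrite !nth_mktuple_nat.
Qed.

Lemma recursive_const k c : recursive (fun _ : k.-tuple nat => c).
Proof.
elim: c => [|c IHc].
  apply: (@rec_comp 0 k (fun=> 0) (fun _ _ => 0)) => //; first exact: rec_zero.
  by case.
apply: (@recursive1_comp k succn) IHc.
by apply: rec_succ => v; rewrite /thead (tnth_nth 0).
Qed.

Lemma recursive1_prim c g h : recursive2 g ->
  h 0 = c -> (forall n, h n.+1 = g n (h n)) -> recursive1 h.
Proof.
by move=> rg h0 hS; apply: (rec_prim (recursive_const 0 c) rg) => [v|n v] /=.
Qed.

Lemma recursive2_prim f g h : recursive1 f -> recursive3 g ->
    (forall x, h 0 x = f x) -> (forall n x, h n.+1 x = g n (h n x) x) ->
  recursive2 h.
Proof. by move=> rf rg h0 hS; apply: (rec_prim rf rg) => [v|n v] /=. Qed.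

Lemma recursive1_succn : recursive1 succn.
Proof. by apply: rec_succ => v; rewrite /thead (tnth_nth 0). Qed.

Lemma recursive2_addn : recursive2 addn.
Proof.
apply: (@recursive2_prim id (fun _ m _ => m.+1)) => //.
- exact: recursive_nth.
- by apply: (recursive1_comp recursive1_succn); apply: recursive_nth.
Qed.

Lemma recursive1_predn : recursive1 predn.
Proof.
by apply: (@recursive1_prim 0 (fun n _ => n)) => //; apply: recursive_nth.
Qed.

Lemma recursive2_subn : recursive2 subn.
Proof.
have rsub : recursive2 (fun n m => m - n).
  apply: (@recursive2_prim id (fun _ m _ => m.-1)) => [||x|n x].
  - exact: recursive_nth.
  - by apply: (recursive1_comp recursive1_predn); apply: recursive_nth.
  - by rewrite subn0.
  - by rewrite subnS.
by apply: (recursive2_comp rsub); apply: recursive_nth.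
Qed.

Lemma recursive1_double : recursive1 double.
Proof.
have -> : double = fun n => n + n by apply: funext => n; rewrite addnn.
by apply: (recursive2_comp recursive2_addn); apply: recursive_nth.
Qed.

Lemma recursive1_odd : recursive1 (fun n => odd n).
Proof.
apply: (@recursive1_prim 0 (fun _ b => 1 - b)) => [||n] //=.
- apply: (recursive2_comp recursive2_subn); first exact: recursive_const.
  exact: recursive_nth.
- by case: odd.
Qed.

Lemma recursive1_half : recursive1 half.
Proof.
apply: (@recursive1_prim 0 (fun n m => odd n + m)) => [||n] //=.
- apply: (recursive2_comp recursive2_addn); last exact: recursive_nth.
  by apply: (recursive1_comp recursive1_odd); apply: recursive_nth.
- by rewrite uphalf_half.
Qed.

Lemma recursive2_iter f : recursive1 f -> recursive2 (fun n x => iter n f x).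
Proof.
move=> rf; apply: (@recursive2_prim id (fun _ m _ => f m)) => //.
- exact: recursive_nth.
- by apply: (recursive1_comp rf); apply: recursive_nth.
Qed.

Lemma recursive3_if :
  recursive3 (fun n x y => if n == 0 then x else y).
Proof.
apply: (@rec_prim 2 (fun v => nth 0 v 0) (fun v => nth 0 v 3)) => [|||n v] //.
- exact: recursive_nth.
- exact: recursive_nth.
Qed.

(** * Recursive coding of lists *)

Definition code_cons a c := 2 ^ a * c.*2.+1.
Definition code_head c := head 0 (CodeSeq.decode c).
Definition code_tail c := CodeSeq.code (behead (CodeSeq.decode c)).

Lemma code_headK a c : code_head (code_cons a c) = a.
Proof. by rewrite -[c]CodeSeq.decodeK /code_head (CodeSeq.codeK (a :: _)). Qed.

Lemma code_tailK a c : code_tail (code_cons a c) = c.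
Proof.
by rewrite -[c]CodeSeq.decodeK /code_tail (CodeSeq.codeK (a :: _)).
Qed.

Lemma codeP c : c = 0 \/ exists a d, c = code_cons a d.
Proof.
rewrite -[c]CodeSeq.decodeK; case: CodeSeq.decode => [|a s]; first by left.
by right; exists a, (CodeSeq.code s).
Qed.

(** Halving strips the factors 2 from the code one at a time: the exponent,
    which is the head of the list, is the number of halvings before an odd
    number shows up. *)
Lemma iter_half n a c : n <= a ->
  iter n half (code_cons a c) = code_cons (a - n) c.
Proof.
elim: n => [|n IHn] lena /=; first by rewrite subn0.
rewrite (IHn (ltnW lena)) /code_cons -[in LHS](subnSK lena).
by rewrite expnS -mulnA mul2n doubleK.
Qed.

Lemma odd_code_cons a c : odd (code_cons a c) = (a == 0).
Proof. by rewrite oddM oddX /= odd_double andbT orbF. Qed.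

Lemma recursive2_code_cons : recursive2 code_cons.
Proof.
have -> : code_cons = fun a c => iter a double c.*2.+1.
  apply: funext => a; apply: funext => c; rewrite /code_cons.
  by elim: a => [|a IHa] /=; rewrite ?mul1n // expnS -mulnA IHa mul2n.
apply: (recursive2_comp (recursive2_iter recursive1_double)).
  exact: recursive_nth.
apply: (recursive1_comp recursive1_succn).
by apply: (recursive1_comp recursive1_double); apply: recursive_nth.
Qed.

(** The head is found by minimization, as the least number of halvings which
    leads to an odd number. *)
Lemma recursive1_code_head : recursive1 code_head.
Proof.
have rhalf := recursive2_iter recursive1_half.
(* The term 1 - c stops the search at once on c = 0, which codes the empty
   list and has no odd half. *)
apply: (@rec_mu _ (fun v : 2.-tuple nat =>
  1 - odd (iter (nth 0 v 0) half (nth 0 v 1)) - (1 - nth 0 v 1))).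
  apply: (recursive2_comp recursive2_subn);
    apply: (recursive2_comp recursive2_subn); try exact: recursive_const.
    apply: (recursive1_comp recursive1_odd).
    by apply: (recursive2_comp rhalf); apply: recursive_nth.
  exact: recursive_nth.
move=> v; rewrite /=; case: (codeP (nth 0 v 0)) => [->|[a [c ->]]].
  by split=> //; case: (odd _).
rewrite code_headK iter_half // subnn odd_code_cons; split=> // n ltna.
rewrite iter_half ?(ltnW ltna) // odd_code_cons subn_eq0 leqNgt ltna /=.
by rewrite (_ : 1 - code_cons a c = 0) //; apply/eqP; rewrite subn_eq0 muln_gt0
  expn_gt0.
Qed.

Lemma recursive1_code_tail : recursive1 code_tail.
Proof.
have -> : code_tail = fun c => half (iter (code_head c) half c).
  apply: funext => c; case: (codeP c) => [->//|[a [d ->]]].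
  rewrite code_headK code_tailK iter_half // subnn /code_cons mul1n /=.
  by rewrite uphalf_double.
apply: (recursive1_comp recursive1_half).
apply: (recursive2_comp (recursive2_iter recursive1_half)).
  by apply: (recursive1_comp recursive1_code_head); apply: recursive_nth.
exact: recursive_nth.
Qed.

(** * Computable functions between countable types *)

Local Notation pickle := choice.pickle.

(** Specifying [h] on codes alone spares a procedure for recognizing codes. *)
Definition computable (T U : countType) (f : T -> U) : Prop :=
  exists h, recursive1 h /\ forall t, h (pickle t) = pickle (f t).

(** The numbering of pairs is the coding of lists of length two. *)
Definition code_pair a b := code_cons a (code_cons b 0).

Lemma recursive2_code_pair : recursive2 code_pair.
Proof.
apply: (recursive2_comp recursive2_code_cons); first exact: recursive_nth.
apply: (recursive2_comp recursive2_code_cons); last exact: recursive_const.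
exact: recursive_nth.
Qed.

Section Computable.
Variable E : countType.
Implicit Types T U V : countType.

Lemma computable_id : computable (fun e : E => e).
Proof. by exists id; split=> //; apply: recursive_nth. Qed.

Lemma computable_comp T U (g : T -> U) (f : E -> T) :
  computable g -> computable f -> computable (fun e => g (f e)).
Proof.
move=> [h [rh hE]] [k [rk kE]]; exists (fun n => h (k n)).
by split=> [|e]; [apply: recursive1_comp rh rk | rewrite kE hE].
Qed.

Lemma computable_const T (t : T) : computable (fun _ : E => t).
Proof.
by exists (fun=> pickle t); split=> //; apply: recursive_const.
Qed.

Lemma computable_pair T U (f : E -> T) (g : E -> U) :
  computable f -> computable g -> computable (fun e => (f e, g e)).
Proof.
move=> [h [rh hE]] [k [rk kE]].
exists (fun n => code_pair (h n) (k n)).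
split=> [|e]; last by rewrite hE kE.
exact: recursive2_comp recursive2_code_pair rh rk.
Qed.

Definition code_second c := code_head (code_tail c).

Lemma code_head_pair T U (p : T * U) : code_head (pickle p) = pickle p.1.
Proof. exact: code_headK. Qed.

Lemma code_second_pair T U (p : T * U) : code_second (pickle p) = pickle p.2.
Proof.
by rewrite /code_second (code_tailK _ (code_cons _ 0)) code_headK.
Qed.

Lemma recursive1_code_second : recursive1 code_second.
Proof. exact: recursive1_comp recursive1_code_head recursive1_code_tail. Qed.

Lemma computable_fst T U (f : E -> T * U) :
  computable f -> computable (fun e => (f e).1).
Proof.
move=> [h [rh hE]]; exists (fun n => code_head (h n)).
split=> [|e]; last by rewrite hE code_head_pair.
exact: recursive1_comp recursive1_code_head rh.
Qed.

Lemma computable_snd T U (f : E -> T * U) :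
  computable f -> computable (fun e => (f e).2).
Proof.
move=> [h [rh hE]]; exists (fun n => code_second (h n)).
split=> [|e]; last by rewrite hE code_second_pair.
exact: recursive1_comp recursive1_code_second rh.
Qed.

Lemma computable_pickle T (f : E -> T) :
  computable f -> computable (fun e => pickle (f e)).
Proof. by []. Qed.

Lemma computable_cons T (f : E -> T) (s : E -> seq T) :
  computable f -> computable s -> computable (fun e => f e :: s e).
Proof.
move=> [h [rh hE]] [k [rk kE]]; exists (fun n => code_cons (h n) (k n)).
split=> [|e]; last by rewrite hE kE.
exact: recursive2_comp recursive2_code_cons rh rk.
Qed.

Lemma computable_if T U (f g : E -> T) (a b : E -> U) :
    computable f -> computable g -> computable a -> computable b ->
  computable (fun e => if f e == g e then a e else b e).
Proof.
move=> [f' [rf fE]] [g' [rg gE]] [a' [ra aE]] [b' [rb bE]].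
exists (fun n => if (f' n - g' n) + (g' n - f' n) == 0 then a' n else b' n).
split=> [|e].
  apply: (recursive3_comp recursive3_if) ra rb.
  by apply: (recursive2_comp recursive2_addn);
    apply: (recursive2_comp recursive2_subn).
rewrite fE gE aE bE addn_eq0 !subn_eq0 -eqn_leq.
by rewrite (inj_eq (pcan_inj choice.pickleK)); case: eqP.
Qed.

End Computable.

(** One step of a left fold on the code of a state (e, (s, u)), where e is the
    environment, s the part of the list still to be read and u the accumulator.
    The state is fixed once s is empty, so that iterating too often does no
    harm. *)
Definition foldl_step (h : nat -> nat) (st : nat) : nat :=
  let s := code_head (code_second st) in
  if s == 0 then st else
  code_pair (code_head st) (code_pair (code_tail s)
    (h (code_pair (code_pair (code_head st) (code_head s))
                  (code_second (code_second st))))).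

Lemma recursive1_foldl_step h : recursive1 h -> recursive1 (foldl_step h).
Proof.
move=> rh; have rst : recursive1 id by apply: recursive_nth.
have rhd : recursive1 code_head := recursive1_code_head.
have rsnd : recursive1 code_second := recursive1_code_second.
have rs : recursive1 (fun st => code_head (code_second st)).
  exact: recursive1_comp rhd rsnd.
have rpair (a b : 1.-tuple nat -> nat) : recursive a -> recursive b ->
    recursive (fun v => code_pair (a v) (b v)).
  by move=> ra rb; apply: recursive2_comp recursive2_code_pair ra rb.
apply: (recursive3_comp recursive3_if rs rst).
apply: (rpair); first exact: rhd.
apply: (rpair); first exact: recursive1_comp recursive1_code_tail rs.
apply: (recursive1_comp rh); apply: (rpair).
  by apply: (rpair); [exact: rhd | apply: recursive1_comp rhd rs].
exact: (recursive1_comp rsnd rsnd).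
Qed.

Lemma code_eq0 s : (CodeSeq.code s == 0) = nilp s.
Proof. by case: s => [|a s] //=; rewrite muln_eq0 expn_eq0. Qed.

(** The code of a list bounds its length, hence provides enough iterations of
    [foldl_step]. *)
Lemma leq_size_code s : size s <= CodeSeq.code s.
Proof.
elim: s => //= a s IHs; rewrite -[X in X < _]mul1n.
apply: (@leq_trans (1 * (CodeSeq.code s).*2.+1)).
  by rewrite !mul1n ltnS -addnn (leq_trans IHs) ?leq_addr.
by rewrite leq_mul2r expn_gt0 orbT.
Qed.

Section Folds.
Variables E T U : countType.

(** Here, and in the lemmas on list functions below, [E] is the type of an
    environment: the function being folded may depend on the parameter [e],
    which is what makes nested folds expressible. *)
Lemma computable_foldl (g : E -> T -> U -> U) (s : E -> seq T) (z : E -> U) :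
    computable (fun p : E * T * U => g p.1.1 p.1.2 p.2) ->
    computable s -> computable z ->
  computable (fun e => foldl (fun u x => g e x u) (z e) (s e)).
Proof.
move=> [h [rh hE]] cs cz.
have [k [rk kE]] := computable_pair (computable_id _) (computable_pair cs cz).
pose step := foldl_step h.
have stepE e x t u : step (pickle (e, (x :: t, u))) = pickle (e, (t, g e x u)).
  rewrite /step /foldl_step !code_second_pair !code_head_pair code_eq0 /=.
  by rewrite code_headK code_tailK; congr code_pair; congr code_pair;
    apply: (hE (e, x, u)).
have step0 e u :
    step (pickle (e, ([::] : seq T, u))) = pickle (e, ([::] : seq T, u)).
  by rewrite /step /foldl_step code_second_pair code_head_pair.
have iterE n e t u : size t <= n -> iter n step (pickle (e, (t, u)))
    = pickle (e, ([::] : seq T, foldl (fun u x => g e x u) u t)).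
  elim: n t u => [|n IHn] [|x t] u // letn; rewrite iterSr ?step0 ?stepE;
    exact: IHn.
exists (fun n => code_second (code_second
  (iter (code_head (code_second (k n))) step (k n)))).
split=> [|e].
  do 2?apply: (recursive1_comp recursive1_code_second).
  apply: (recursive2_comp (recursive2_iter (recursive1_foldl_step rh)) _ rk).
  apply: (recursive1_comp recursive1_code_head).
  exact: recursive1_comp recursive1_code_second rk.
rewrite kE !code_second_pair code_head_pair iterE ?code_second_pair //=.
by rewrite -(size_map pickle) leq_size_code.
Qed.

End Folds.

Lemma computable_rev (T : countType) : computable (@rev T).
Proof.
have -> : @rev T = fun s => foldl (fun u x => x :: u) [::] s.
  apply: funext => s; rewrite -[LHS]cats0 -[X in X ++ _]/(rev s).
  by rewrite -catrevE; elim: s [::] => //= x s IHs t; rewrite -IHs.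
apply: (computable_foldl (g := fun (_ : seq T) x u => x :: u)).
- apply: computable_cons; last exact/computable_snd/computable_id.
  exact/computable_snd/computable_fst/computable_id.
- exact: computable_id.
- exact: computable_const.
Qed.

Implicit Types E T U V : countType.

Lemma computable_foldr E T U (g : E -> T -> U -> U) (s : E -> seq T)
    (z : E -> U) :
    computable (fun p : E * T * U => g p.1.1 p.1.2 p.2) ->
    computable s -> computable z ->
  computable (fun e => foldr (g e) (z e) (s e)).
Proof.
move=> cg cs cz.
have -> : (fun e => foldr (g e) (z e) (s e))
    = (fun e => foldl (fun u x => g e x u) (z e) (rev (s e))).
  by apply: funext => e; rewrite foldl_rev.
apply: computable_foldl => //; exact: computable_comp (@computable_rev T) cs.
Qed.

Lemma computable_cat E T (s t : E -> seq T) :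
  computable s -> computable t -> computable (fun e => s e ++ t e).
Proof.
move=> cs ct.
have -> : (fun e => s e ++ t e) = (fun e => foldr cons (t e) (s e)).
  by apply: funext => e; elim: (s e) => //= x u ->.
apply: (computable_foldr (g := fun _ => cons)) => //.
apply: computable_cons; last exact/computable_snd/computable_id.
exact/computable_snd/computable_fst/computable_id.
Qed.

Lemma computable_map E T U (f : E -> T -> U) (s : E -> seq T) :
    computable (fun p : E * T => f p.1 p.2) -> computable s ->
  computable (fun e => [seq f e x | x <- s e]).
Proof.
move=> cf cs.
have -> : (fun e => [seq f e x | x <- s e])
    = (fun e => foldr (fun x t => f e x :: t) [::] (s e)).
  by apply: funext => e; elim: (s e) => //= x u ->.
apply: (computable_foldr (g := fun e x t => f e x :: t)) => //.
  apply: computable_cons; last exact/computable_snd/computable_id.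
  exact: computable_comp cf (computable_fst (computable_id _)).
exact: computable_const.
Qed.

Lemma computable_flatten_map E T U (f : E -> T -> seq U) (s : E -> seq T) :
    computable (fun p : E * T => f p.1 p.2) -> computable s ->
  computable (fun e => flatten [seq f e x | x <- s e]).
Proof.
move=> cf cs.
have -> : (fun e => flatten [seq f e x | x <- s e])
    = (fun e => foldr (fun x t => f e x ++ t) [::] (s e)).
  by apply: funext => e; elim: (s e) => //= x u ->.
apply: (computable_foldr (g := fun e x t => f e x ++ t)) => //.
  apply: computable_cat; last exact/computable_snd/computable_id.
  exact: computable_comp cf (computable_fst (computable_id _)).
exact: computable_const.
Qed.

Lemma computable_allpairs E T U V (f : E -> T -> U -> V) (s : E -> seq T)
    (t : E -> seq U) :
    computable (fun p : E * T * U => f p.1.1 p.1.2 p.2) ->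
    computable s -> computable t ->
  computable (fun e => [seq f e x y | x <- s e, y <- t e]).
Proof.
move=> cf cs ct.
apply: (computable_flatten_map (f := fun e x => map (f e x) (t e))) => //.
apply: (computable_map (f := fun p => f p.1 p.2)) => //.
exact: computable_comp ct (computable_fst (computable_id _)).
Qed.

Lemma computable_filter_eq E T U (f : T -> U) (u : E -> U) (s : E -> seq T) :
    computable f -> computable u -> computable s ->
  computable (fun e => [seq x <- s e | f x == u e]).
Proof.
move=> cf cu cs.
have -> : (fun e => [seq x <- s e | f x == u e])
    = (fun e => foldr (fun x t => if f x == u e then x :: t else t) [::] (s e)).
  by apply: funext => e; elim: (s e) => //= x t ->.
apply: (computable_foldr
  (g := fun e x t => if f x == u e then x :: t else t)) => //; last first.
  exact: computable_const.
have c1 := @computable_id (E * T * seq T)%type.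
have c11 := computable_fst (computable_fst c1).
have c12 := computable_snd (computable_fst c1).
apply: computable_if (computable_comp cf c12) (computable_comp cu c11) _ _.
  exact: computable_cons c12 (computable_snd c1).
exact: computable_snd c1.
Qed.

Lemma computable_if_mem E T U (x : E -> T) (s : E -> seq T) (a b : E -> U) :
    computable x -> computable s -> computable a -> computable b ->
  computable (fun e => if x e \in s e then a e else b e).
Proof.
move=> cx cs ca cb.
have -> : (fun e => if x e \in s e then a e else b e)
    = (fun e => foldr (fun y t => if x e == y then a e else t) (b e) (s e)).
  apply: funext => e; elim: (s e) => //= y t <-; rewrite inE.
  by case: (_ == y).
apply: (computable_foldr
  (g := fun e y t => if x e == y then a e else t)) => //.
have c1 := @computable_id (E * T * U)%type.
have c11 := computable_fst (computable_fst c1).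
apply: computable_if (computable_comp cx c11) _ (computable_comp ca c11) _.
  exact/computable_snd/computable_fst.
exact: computable_snd.
Qed.

Lemma computable_undup E T (s : E -> seq T) :
  computable s -> computable (fun e => undup (s e)).
Proof.
move=> cs.
have -> : (fun e => undup (s e))
    = (fun e => foldr (fun x t => if x \in t then t else x :: t) [::] (s e)).
  by apply: funext => e; elim: (s e) => //= x t <-; rewrite mem_undup.
apply: (computable_foldr (g := fun (_ : E) (x : T) (t : seq T) =>
  if x \in t then t else x :: t)) => //; last first.
  exact: computable_const.
have c1 := @computable_id (E * T * seq T)%type.
have c2 := computable_snd c1.
have c12 := computable_snd (computable_fst c1).
exact: (computable_if_mem c12 c2 c2 (computable_cons c12 c2)).
Qed.

(** * Decidable sets *)

Lemma decidable_preimage (T U : countType) (f : T -> U) (D : set U) :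
  computable f -> decidable_set D -> decidable_set (f @^-1` D).
Proof.
move=> [h [rh hE]] [k [rk kD]].
exists (fun v : 1.-tuple nat => k [tuple h (nth 0 v 0)]).
split=> [|t]; last by rewrite /= hE; apply: kD.
apply: (rec_comp rk (fun _ : 'I_1 => rh)) => v; congr k.
by apply: eq_from_tnth => i; rewrite tnth_mktuple ord1.
Qed.

Lemma decidable_setC (T : countType) (D : set T) :
  decidable_set D -> decidable_set (~` D).
Proof.
move=> [k [rk kD]].
(* This expression in the value k v is 0 if that value is 1, and 1 otherwise. *)
exists (fun v => 1 - (1 - (k v - 1) - (1 - k v))); split.
  have r1 := recursive_const 1 1.
  have rsub (a b : 1.-tuple nat -> nat) : recursive a -> recursive b ->
      recursive (fun v => a v - b v).
    by move=> ra rb; apply: recursive2_comp recursive2_subn ra rb.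
  by do 3?apply: (rsub) => //; apply: (rsub).
move=> t; split=> [nDt|kt /kD Dt]; last by rewrite Dt in kt.
have : k [tuple choice.pickle t] <> 1 by move/kD.
by case: (k _) => [|[|n]].
Qed.

(** * Words and lifts of patterns *)

Fixpoint words (A : seq nat) (n : nat) : seq (seq nat) :=
  if n is m.+1 then [seq a :: q | a <- A, q <- words A m] else [:: [::]].

Lemma mem_words A n q : (q \in words A n) = (size q == n) && all (mem A) q.
Proof.
elim: n q => [|n IHn] [|a q] //=.
  by apply/negbTE/negP => /allpairsP[[b t] /= [_ _]].
apply/allpairsP/idP => [[[b t] /= [Ab tn [-> ->]]]|].
  by move: tn; rewrite IHn eqSS Ab.
by rewrite eqSS => /and3P[qn Aa Aq]; exists (a, q); rewrite IHn qn.
Qed.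

Lemma computable_words n : computable (fun A => words A n).
Proof.
elim: n => [|n IHn]; first exact: computable_const.
apply: (computable_allpairs (f := fun _ => cons) _ (computable_id _) IHn).
apply: computable_cons; last exact/computable_snd/computable_id.
exact/computable_snd/computable_fst/computable_id.
Qed.

Definition lookup (t : seq (seq nat * nat)) (q : seq nat) : nat :=
  nth 0 (unzip2 t) (index q (unzip1 t)).

(** A lookup in a fixed table is a finite cascade of comparisons. *)
Lemma computable_lookup t : computable (lookup t).
Proof.
elim: t => [|[q b] t IHt].
  have -> : lookup [::] = fun=> 0.
    by apply: funext => q; rewrite /lookup nth_nil.
  exact: computable_const.
have -> : lookup ((q, b) :: t) = fun q' => if q == q' then b else lookup t q'.
  by apply: funext => q'; rewrite /lookup /=; case: eqP.
apply: computable_if (computable_const _ _) (computable_id _) _ IHt.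
exact: computable_const.
Qed.

Section Lifts.
Variable W : countType.
Implicit Types (A : seq nat) (d : nat -> nat) (p q : seq (W * nat)).

(** The patterns over the alphabet [A] which become [p] when the letter map [d]
    is applied; see [mem_lifts]. *)
Definition lifts d A p : seq (seq (W * nat)) :=
  foldr (fun wa qs =>
      [seq (wa.1, c) :: q | c <- [seq c <- A | d c == wa.2], q <- qs])
    [:: [::]] p.

Lemma mem_lifts d A p q : (q \in lifts d A p) =
  all (mem A) (unzip2 q) && ([seq (wc.1, d wc.2) | wc <- q] == p).
Proof.
elim: p q => [|[w a] p IHp] q /=.
  by rewrite inE; case: q => [|wc q] //=; rewrite andbF.
apply/allpairsP/idP => [[[c t] /= [Ac tp ->]]|] /=.
  move: Ac tp; rewrite mem_filter IHp => /andP[/eqP-> Ac] /andP[At /eqP->].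
  by rewrite Ac At eqxx.
case: q => [|[w' c] q]; rewrite ?andbF //=.
case/andP=> /andP[Ac Aq] /eqP[-> dc dq].
exists (c, q); split=> //=; first by rewrite mem_filter dc eqxx.
by rewrite IHp Aq dq eqxx.
Qed.

Lemma computable_lifts d : computable d ->
  computable (fun Ap : seq nat * seq (W * nat) => lifts d Ap.1 Ap.2).
Proof.
move=> cd.
apply: (computable_foldr (g := fun (Ap : seq nat * seq (W * nat)) wa qs =>
  [seq (wa.1, c) :: q | c <- [seq c <- Ap.1 | d c == wa.2], q <- qs])).
- pose E := (seq nat * seq (W * nat) * (W * nat) * seq (seq (W * nat)))%type.
  have ce := @computable_id E.
  have cA := computable_fst (computable_fst (computable_fst ce)).
  have cwa := computable_snd (computable_fst ce).
  apply: (computable_allpairs (f := fun (e : E) c q => (e.1.2.1, c) :: q)).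
  + have ci := @computable_id (E * nat * seq (W * nat))%type.
    have cw := computable_comp (computable_fst cwa)
      (computable_fst (computable_fst ci)).
    apply: computable_cons (computable_snd ci).
    exact: computable_pair cw (computable_snd (computable_fst ci)).
  + exact: computable_filter_eq cd (computable_snd cwa) cA.
  + exact: computable_snd ce.
- exact/computable_snd/computable_id.
- exact: computable_const.
Qed.

End Lifts.

(** * The product of a sofic subshift with an SFT *)

Section Product.
Variables (G : groupType) (S : {fset G}).
Implicit Types (A : seq nat) (d : nat -> nat) (p : pattern S) (x : config G).

(** Avoiding all lifts of a pattern amounts to avoiding the pattern after
    projection, because the lift that matters is read off the configuration
    itself. *)
Lemma appears_lifts d A p x g : (forall h, x h \in A) ->
  (exists2 q, q \in lifts d A p & appears q x g) <-> appears p (d \o x) g.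
Proof.
move=> xA; split=> [[q]|pxg].
  rewrite mem_lifts => /andP[_ /eqP <-] qxg w a /mapP[[v c] qvc /= [-> ->]].
  by rewrite (qxg _ _ qvc).
exists [seq (wa.1, x (g * word_eval wa.1)%g) | wa <- p]; last first.
  by move=> w a /mapP[[v c] _ [-> ->]].
rewrite mem_lifts -map_comp; apply/andP; split.
  by apply/allP => c /mapP[_ /mapP[wa _ ->] ->]; apply: xA.
apply/eqP; rewrite -[RHS]map_id; apply/eq_in_map => -[w a] pwa /=.
by have /= -> := pxg _ _ pwa.
Qed.

Lemma pattern_over_lifts d A A' p q :
  pattern_over A p -> q \in lifts d A' p -> pattern_over A' q.
Proof.
rewrite /pattern_over mem_lifts => /andP[up _] /andP[-> /eqP eqp].
by move: up; rewrite -eqp /unzip1 -map_comp andbT.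
Qed.

Definition product_alphabet (A A0 : seq nat) : seq nat :=
  [seq choice.pickle (a, b) | a <- A, b <- A0].

Lemma mem_product_alphabet A A0 c : c \in product_alphabet A A0 ->
  (code_head c \in A) /\ (code_second c \in A0).
Proof.
by case/allpairsP=> -[a b] [Aa Ab ->]; rewrite code_head_pair code_second_pair.
Qed.

Definition product_rules A A0 (F F0 : seq (pattern S)) : seq (pattern S) :=
  let A' := product_alphabet A A0 in
  flatten [seq lifts code_head A' p | p <- F] ++
  flatten [seq lifts code_second A' p | p <- F0].

Definition product_raw (P P0 : seq nat * seq (pattern S)) :
    seq nat * seq (pattern S) :=
  (product_alphabet P.1 P0.1, product_rules P.1 P0.1 P.2 P0.2).

Lemma product_subproof (P P0 : sft_presentation S) :
  let R := product_raw (val P) (val P0) in all (pattern_over R.1) R.2.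
Proof.
rewrite /= all_cat; apply/andP; split; apply/allP => q /flatten_mapP[p Fp].
  by apply: pattern_over_lifts; apply: (allP (valP P) p Fp).
by apply: pattern_over_lifts; apply: (allP (valP P0) p Fp).
Qed.

Definition product_sft (P P0 : sft_presentation S) : sft_presentation S :=
  exist _ (product_raw (val P) (val P0)) (product_subproof P P0).

Lemma product_sftP (P P0 : sft_presentation S) x : sft (product_sft P P0) x <->
  [/\ forall g, x g \in product_alphabet (val P).1 (val P0).1,
      sft P (code_head \o x) & sft P0 (code_second \o x)].
Proof.
split=> [[xA xF]|[xA [_ xF] [_ xF0]]].
  split=> //; split=> [g|p Fp g]; try by case: (mem_product_alphabet (xA g)).
    move/(appears_lifts _ _ _ xA) => [q pq]; apply: xF.
    by rewrite mem_cat; apply/orP; left; apply/flatten_mapP; exists p.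
  move/(appears_lifts _ _ _ xA) => [q pq]; apply: xF.
  by rewrite mem_cat; apply/orP; right; apply/flatten_mapP; exists p.
split=> // q + g qxg.
rewrite mem_cat => /orP[] /flatten_mapP[p Fp pq].
  by apply: (xF p Fp g); apply/(appears_lifts _ _ _ xA); exists q.
by apply: (xF0 p Fp g); apply/(appears_lifts _ _ _ xA); exists q.
Qed.

(** The local function of the second factor, as a function of product letters.
    The table has to list each word over the alphabet exactly once, while the
    alphabet of a presentation may have repetitions, whence [undup]. *)
Definition lift_local (A' : seq nat) (mu : local_function S) :
    local_function S :=
  (mu.1, [seq (q, lookup mu.2 (map code_second q))
         | q <- undup (words A' (size mu.1))]).

Lemma lookup_over A B (mu : local_function S) (q : seq nat) :
    local_function_over A B mu -> size q = size mu.1 -> all (mem A) q ->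
  lookup mu.2 q \in B.
Proof.
case/and5P=> _ _ _ /forallP mu_total muB sizeq Aq.
have [t def_q] : exists t : seq (seq_sub A), q = [seq ssval a | a <- t].
  elim: q Aq {sizeq} => [|a q IHq] /=; first by exists [::].
  by case/andP=> Aa /IHq[t ->]; exists (SeqSub Aa :: t).
have sizet : size t == size mu.1 by rewrite -sizeq def_q size_map.
have := mu_total (Tuple sizet); rewrite /= -def_q -index_mem => ltq.
apply: (allP muB); apply: mem_nth.
by rewrite size_map -(size_map (@fst (seq nat) nat)).
Qed.

Lemma lift_local_over A A0 B (mu : local_function S) :
  local_function_over A0 B mu ->
  local_function_over (product_alphabet A A0) B
    (lift_local (product_alphabet A A0) mu).
Proof.
set A' := product_alphabet A A0 => mu_over; pose W := words A' (size mu.1).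
have keys : unzip1 (lift_local A' mu).2 = undup W.
  by rewrite /unzip1 -map_comp map_id.
rewrite /local_function_over keys undup_uniq /=; apply/and4P; split.
- by case/and5P: mu_over.
- by apply/allP => q; rewrite mem_undup mem_words.
- apply/forallP => q; rewrite mem_undup mem_words size_map size_tuple eqxx.
  by apply/allP => _ /mapP[a _ ->]; apply: ssvalP.
apply/allP => _ /mapP[_ /mapP[q + ->] ->] /=; rewrite mem_undup mem_words.
case/andP=> /eqP sizeq /allP A'q; apply: lookup_over mu_over _ _.
  by rewrite size_map.
by apply/allP => _ /mapP[c qc ->]; case: (mem_product_alphabet (A'q c qc)).
Qed.

Lemma local_map_lift A' (mu : local_function S) x : (forall g, x g \in A') ->
  local_map (lift_local A' mu) x = local_map mu (code_second \o x).
Proof.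
move=> xA; apply: funext => g; rewrite /local_map /local_value /=.
set y := shift _ x; set q := [seq y _ | w <- _].
have yq : q \in undup (words A' (size mu.1)).
  rewrite mem_undup mem_words size_map eqxx.
  by apply/allP => _ /mapP[w _ ->]; apply: xA.
rewrite /unzip1 /unzip2 -!map_comp map_id.
rewrite (nth_map [::]) ?index_mem // nth_index //= /lookup -map_comp.
by [].
Qed.

(** The SFT covering [Q] is the second factor of the product; the first factor
    [P] only decides whether the product is empty. *)
Definition product_sofic (Q : sofic_presentation S) (P : sft_presentation S) :
    sofic_presentation S :=
  let: exist ((P0, mu), B) mu_over := Q in
  exist _ (product_sft P P0, lift_local (val (product_sft P P0)).1 mu, B)
    (lift_local_over (val P).1 mu_over).

(** A fixed point z of the first factor completes every point of the cover of
    [Q] to a point of the product, so no point of the image is lost. *)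
Lemma product_sofic_nonempty Q P :
  sft P !=set0 -> sofic_subshift (product_sofic Q P) = sofic_subshift Q.
Proof.
case: Q => -[[P0 mu] B] mu_over [z Pz]; apply/seteqP; split=> y /=.
  case=> x /product_sftP[xA _ P0x] <-; exists (code_second \o x) => //=.
  by rewrite local_map_lift.
case=> x P0x <-; pose zx : config G := fun g => choice.pickle (z g, x g).
have zxA g : zx g \in product_alphabet (val P).1 (val P0).1.
  by apply: (allpairs_f (fun a b => choice.pickle (a, b)) (Pz.1 g) (P0x.1 g)).
have zx1 : code_head \o zx = z.
  by apply: funext => g; apply: (code_head_pair (z g, x g)).
have zx2 : code_second \o zx = x.
  by apply: funext => g; apply: (code_second_pair (z g, x g)).
exists zx; first by apply/product_sftP; rewrite zx1 zx2.
by rewrite /= local_map_lift // zx2.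
Qed.

Lemma product_sofic_empty Q P :
  sft P = set0 -> sofic_subshift (product_sofic Q P) = set0.
Proof.
case: Q => -[[P0 mu] B] mu_over P_empty; apply/seteqP; split=> y //= [x].
by case/product_sftP=> _; rewrite P_empty.
Qed.

Lemma computable_product_raw (P0 : seq nat * seq (pattern S)) :
  computable (fun P => product_raw P P0).
Proof.
pose E := (seq nat * seq (pattern S))%type.
have ce := @computable_id E.
have cA : computable (fun P : E => product_alphabet P.1 P0.1).
  apply: (computable_allpairs
    (f := fun (_ : E) (a b : nat) => choice.pickle (a, b))).
  - have ci := @computable_id (E * nat * nat)%type.
    apply: computable_pickle; apply: computable_pair (computable_snd ci).
    exact: computable_snd (computable_fst ci).
  - exact: computable_fst.
  - exact: computable_const.
have clift d (F : E -> seq (pattern S)) : recursive1 d -> computable F ->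
    computable (fun P : E =>
      flatten [seq lifts d (product_alphabet P.1 P0.1) p | p <- F P]).
  move=> rd cF; apply: (computable_flatten_map
    (f := fun P p => lifts d (product_alphabet P.1 P0.1) p)) => //.
  have cd : computable d by exists d.
  have ci := @computable_id (E * pattern S)%type.
  have cAi := computable_comp cA (computable_fst ci).
  exact: computable_comp (computable_lifts _ cd)
    (computable_pair cAi (computable_snd ci)).
apply: computable_pair => //; apply: computable_cat.
  exact: clift recursive1_code_head (computable_snd ce).
exact: clift recursive1_code_second (computable_const _ _).
Qed.

Lemma computable_lift_local (mu : local_function S) :
  computable (fun A' => lift_local A' mu).
Proof.
apply: computable_pair; first exact: computable_const.
have cd : computable code_second.
  by exists code_second; split=> //; apply: recursive1_code_second.
apply: (computable_map
  (f := fun (_ : seq nat) q => (q, lookup mu.2 (map code_second q)))).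
  have cq := computable_snd (@computable_id (seq nat * seq nat)%type).
  apply: (computable_pair cq); apply: computable_comp (computable_lookup _) _.
  apply: (computable_map (f := fun _ => code_second)) cq.
  exact: computable_comp cd (computable_snd (computable_id _)).
exact: computable_undup (computable_words _).
Qed.

(** A presentation and the raw data under it have the same number, so it
    suffices to compute the raw data. *)
Lemma computable_product_sofic Q : computable (product_sofic Q).
Proof.
case: Q => -[[P0 mu] B] mu_over.
have [h [rh hE]] : computable (fun P : seq nat * seq (pattern S) =>
    let R := product_raw P (val P0) in (R, lift_local R.1 mu, B)).
  have cR := computable_product_raw (val P0).
  apply: computable_pair (computable_const _ _).
  apply: (computable_pair cR).
  exact: computable_comp (computable_lift_local mu) (computable_fst cR).
exists h; split=> // P; exact: hE (val P).
Qed.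

(** A decidable property which holds for the presentations of the empty subshift
    and fails for those of the subshift of [Q] tells, through the product with
    [Q], which SFTs are empty. *)
Lemma decidable_DP (Q : sofic_presentation S) (D : set (sofic_presentation S)) :
    decidable_set D ->
    (forall Q' : sofic_presentation S, sofic_subshift Q' = set0 -> D Q') ->
    (forall Q' : sofic_presentation S,
      sofic_subshift Q' = sofic_subshift Q -> ~ D Q') ->
  decidable_set (@DP G S).
Proof.
move=> decD D0 DQ.
have -> : @DP G S = product_sofic Q @^-1` D.
  apply/seteqP; split=> P /=; first by move/(product_sofic_empty Q)/D0.
  move=> DP; apply: contrapT => /eqP/set0P/(product_sofic_nonempty Q).
  by move/DQ.
exact: decidable_preimage (computable_product_sofic Q) decD.
Qed.

End Product.

Theorem theorem5p1 (G : groupType) (S : {fset G})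
  (symS : symmetric_set S) (genS : generating_set S)
  (undecDP : ~ decidable_set (@DP G S))
  (P : set (config G) -> Prop)
  (dynP : dynamical_property S P)
  (satP : exists Y, sofic S Y /\ P Y)
  (unsatP : exists Y, sofic S Y /\ ~ P Y) :
  ~ decidable_set [set Q : sofic_presentation S | P (sofic_subshift Q)].
Proof.
move=> decP; apply: undecDP.
have [P0|nP0] := pselect (P set0).
  have [_ [[Q <-] nPQ]] := unsatP.
  by apply: (decidable_DP (Q := Q) decP) => Q' /= ->.
have [_ [[Q <-] PQ]] := satP.
by apply: (decidable_DP (Q := Q) (decidable_setC decP)) => Q' /= ->.
Qed.
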